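(* Let $\mathcal{H}$ be a separable Hilbert space and let $\mathcal{W},\mathcal{V}$ be closed subspaces of $\mathcal{H}$ with $\mathcal{H}=\mathcal{W}\oplus\mathcal{V}^{\perp}$. Let $\mathcal{F}=\{f_k\}_{k=1}^{\infty}\subset\mathcal{W}$ and $\mathcal{G}=\{g_k\}_{k=1}^{\infty}\subset\mathcal{V}$ be $\epsilon$-approximate oblique dual frames with $0\le\epsilon<1$. Then $I-(\pi_{\mathcal{V}\mathcal{W}^{\perp}}-T_{\mathcal{G}}T_{\mathcal{F}}^{*})$ is invertible and $$L:=\big(I-(\pi_{\mathcal{V}\mathcal{W}^{\perp}}-T_{\mathcal{G}}T_{\mathcal{F}}^{*})\big)^{-1}=I+\sum_{n=1}^{\infty}\big(\pi_{\mathcal{V}\mathcal{W}^{\perp}}-T_{\mathcal{G}}T_{\mathcal{F}}^{*}\big)^n.$$ Let $\widetilde{\mathcal{G}}=\{\widetilde{g}_k\}_{k=1}^{\infty}$ with $\widetilde{g}_k=LT_{\mathcal{G}}\delta_k$ and $\widetilde{\mathcal{F}}=\{\widetilde{f}_k\}_{k=1}^{\infty}$ with $\widetilde{f}_k=L^{*}T_{\mathcal{F}}\delta_k$, where $\{\delta_k\}_{k=1}^{\infty}$ is the canonical basis of $\ell^2(\mathbb{N})$. Then: (i) $\widetilde{\mathcal{G}}$ is an oblique dual frame of $\mathcal{F}$ in $\mathcal{V}$. (ii) $\widetilde{\mathcal{F}}$ is an oblique dual frame of $\mathcal{G}$ in $\mathcal{W}$. (iii) $\widetilde{\mathcal{G}}$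 is an $\frac{\epsilon}{1-\epsilon}$-approximate oblique dual frame of $\widetilde{\mathcal{F}}$ in $\mathcal{V}$.
   Context: The direct sum $\mathcal{H}=\mathcal{W}\oplus\mathcal{V}^{\perp}$ (equivalently $\mathcal{H}=\mathcal{V}\oplus\mathcal{W}^{\perp}$) is not assumed orthogonal. $\pi_{\mathcal{W}\mathcal{V}^{\perp}}$ denotes the oblique projection onto $\mathcal{W}$ along $\mathcal{V}^{\perp}$ (identity on $\mathcal{W}$, zero on $\mathcal{V}^{\perp}$); similarly $\pi_{\mathcal{V}\mathcal{W}^{\perp}}$ is the projection onto $\mathcal{V}$ along $\mathcal{W}^{\perp}$. A sequence $\{f_k\}_{k=1}^{\infty}\subset\mathcal{W}$ is a frame for $\mathcal{W}$ if there are $0<\alpha\le\beta<\infty$ with $\alpha\|f\|^2\le\sum_{k}|\langle f,f_k\rangle|^2\le\beta\|f\|^2$ for all $f\in\mathcal{W}$. For such $\mathcal{F}=\{f_k\}$, $T_{\mathcal{F}}:\ell^2(\mathbb{N})\to\mathcal{H}$, $T_{\mathcal{F}}\{c_k\}=\sum_k c_kf_k$ is the synthesis operator, with adjoint $T_{\mathcal{F}}^{*}f=\{\langle f,f_k\rangle\}_k$. Frames $\mathcal{F}$ for $\mathcal{W}$ and $\mathcal{G}$ for $\mathcal{V}$ are $\epsilon$-approximate oblique dual frames ($\epsilon\ge0$) if $\|\pi_{\mathcal{W}\mathcal{V}^{\perp}}-T_{\mathcal{F}}T_{\mathcal{G}}^{*}\|\le\epsilon$ or, equivalently, $\|\pi_{\mathcal{V}\mathcal{W}^{\perp}}-T_{\mathcal{G}}T_{\mathcal{F}}^{*}\|\le\epsilon$;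 one then says $\mathcal{G}$ is an $\epsilon$-approximate oblique dual frame of $\mathcal{F}$ in $\mathcal{V}$ and $\mathcal{F}$ is an $\epsilon$-approximate oblique dual frame of $\mathcal{G}$ in $\mathcal{W}$. For $\epsilon=0$ one says oblique dual frame(s): $T_{\mathcal{F}}T_{\mathcal{G}}^{*}=\pi_{\mathcal{W}\mathcal{V}^{\perp}}$, equivalently $T_{\mathcal{G}}T_{\mathcal{F}}^{*}=\pi_{\mathcal{V}\mathcal{W}^{\perp}}$. *)

(* Defs.v *)
From HB Require Import structures.
From mathcomp Require Import all_boot all_order all_algebra complex.
From mathcomp Require Import all_classical all_reals all_analysis.

Set Implicit Arguments.
Unset Strict Implicit.
Unset Printing Implicit Defensive.

Import Order.TTheory GRing.Theory Num.Theory.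
Import numFieldNormedType.Exports.

Local Open Scope classical_set_scope.
Local Open Scope ring_scope.

(* A scalar field with its conjugation: the reals or the complex numbers.
   In both cases norms take values in the scalar field itself, and an
   inequality [0 <= x] in [R[i]] entails that [x] is real. *)
Variant real_or_complex : forall K : numFieldType, (K -> K) -> Prop :=
| ScalarReal (R : realType) : @real_or_complex R idfun
| ScalarComplex (R : realType) : @real_or_complex R[i] (@conjc R).

Section Operators.
Context {K : numFieldType} {H : normedModType K}.
Implicit Types (A B : H -> H) (e : K).

Definition bounded_op A : Prop := linear A /\ continuous A.

(* Meaningful for [bounded_op A] only: [supremum] defaults to 0 when there is
   no least upper bound. *)
Definition opnorm A : K :=
  supremum 0 [set `|A x| | x in [set x : H | `|x| <= 1]].

Definition opnorm_le A e : Prop := bounded_op A /\ opnorm A <= e.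

Definition opnorm_cvg (S : nat -> H -> H) A : Prop :=
  (forall n, bounded_op (S n \- A)) /\ opnorm (S n \- A) @[n --> \oo] --> 0.

(* [B] is the inverse of [A] in the algebra of bounded operators. *)
Definition bounded_inverse A B : Prop :=
  [/\ bounded_op A, bounded_op B, cancel A B & cancel B A].

Definition closed_subspace (W : set H) : Prop :=
  [/\ W 0, (forall (a : K) x y, W x -> W y -> W (a *: x + y)) & closed W].

Definition direct_sum (W U : set H) : Prop :=
  [set w + u | w in W & u in U] = setT /\ W `&` U = [set 0].

(* The projection onto [W] along [U], provided [direct_sum W U]. *)
Definition oblique_proj (W U : set H) (x : H) : H :=
  xget 0 [set w | W w /\ U (x - w)].

End Operators.

Section Frames.
Context {K : numFieldType} {conj : K -> K} {H : normedModType K}.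
Variable dot : {dot H for conj}.
Implicit Types (W V : set H) (F G : nat -> H).

Definition orthc V : set H := [set x | forall v, V v -> dot x v = 0].

(* The Hilbert space adjoint; for bounded [A] it is given by the Riesz
   representation theorem. *)
Definition adjoint (A : H -> H) (y : H) : H :=
  xget 0 [set z | forall x, dot (A x) y = dot x z].

Definition frame W F : Prop :=
  (forall k, W (F k)) /\
  exists alpha beta : K, [/\ 0 < alpha, alpha <= beta &
    forall f, W f ->
      let u : nat -> K := series (fun k => `|dot f (F k)| ^+ 2) in
      [/\ cvgn u, alpha * `|f| ^+ 2 <= limn u & limn u <= beta * `|f| ^+ 2]].

(* [synthesis F] and [analysis F] are T_F and T_F^*.  Elements of l^2 are
   represented as scalar sequences.  For a frame [F], the series defining
   [synthesis F c] converges when [c] is square summable, and so in particular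
   for [c = analysis G f] with [G] a frame and for [c = delta k]; it is used
   only at such sequences. *)
Definition synthesis F (c : nat -> K) : H := limn (series (fun k => c k *: F k)).

Definition analysis F (f : H) : nat -> K := fun k => dot f (F k).

Definition delta (k : nat) : nat -> K := fun j => (j == k)%:R.

Definition approx_oblique_dual W V (eps : K) F G : Prop :=
  [/\ frame W F, frame V G &
    opnorm_le (oblique_proj W (orthc V) \- (synthesis F \o analysis G)) eps].

Definition oblique_dual W V F G : Prop :=
  [/\ frame W F, frame V G &
    synthesis F \o analysis G = oblique_proj W (orthc V)].

End Frames.

(* Main.v *)
(* Write P for the projection onto W along V^perp, B = T_F T_G^*, A = T_G T_F^*
   and E = P - B; the hypothesis gives |E x| <= eps |x|.  First, A is adjoint to
   B, whence V + W^perp = H and the projection Q onto V along W^perp is adjoint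
   to P, so that D = Q - A is adjoint to E and inherits its bound.  Let L and M
   be the Neumann inverses of I - D and I - E; they are adjoint to each other.
   As P E = E = E P, one gets B M = P = M B, which are the two duality relations
   for (F, L G) and (M F, G), and T_(M F) T_(L G)^* = M B M = P M, which differs
   from P by E M, of norm at most eps / (1 - eps).  All these sequences satisfy a
   Bessel bound on H, and a Bessel bound for one member of a dual pair gives the
   lower frame bound of the other.  Working with the inequality
   2 s t <= b s^2 + t^2 / b avoids square roots in the scalar field. *)

Require Import Defs.
From HB Require Import structures.
From mathcomp Require Import all_boot all_order all_algebra complex ring.
From mathcomp Require Import all_classical all_reals all_analysis.

Set Implicit Arguments.
Unset Strict Implicit.
Unset Printing Implicit Defensive.

Import Order.TTheory GRing.Theory Num.Theory.
Import numFieldNormedType.Exports.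

Local Open Scope classical_set_scope.
Local Open Scope ring_scope.

(** * Suprema in the scalar field *)

Definition has_lubs (K : numFieldType) : Prop :=
  forall A : set K, A !=set0 -> A `<=` [set x | 0 <= x] -> ubound A !=set0 ->
  supremums A !=set0.

(** A nonnegative element of [R[i]] is real, so the complex case reduces to the supremum of the real
    parts. *)
Lemma real_or_complex_has_lubs (K : numFieldType) (conj : K -> K) :
  real_or_complex conj -> has_lubs K.
Proof.
case=> R A A0 Age0 [M AM].
  have supA : has_sup A by split=> //; exists M.
  exists (sup A); split; first exact/ubP/sup_upper_bound.
  by move=> x Ax; apply: ge_sup.
have eqRe (x : R[i]) : 0 <= x -> x = (complex.Re x)%:C%C.
  by move=> x0; rewrite RRe_real // ger0_real.
have supA : has_sup (@complex.Re R @` A).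
  split; first by case: A0 => x Ax; exists (complex.Re x), x.
  by exists (complex.Re M) => _ [x Ax <-]; move: (AM x Ax); rewrite lecE => /andP[].
exists (sup (@complex.Re R @` A))%:C%C; split.
  move=> x Ax; rewrite (eqRe x (Age0 _ Ax)) lecR.
  by apply: (sup_upper_bound supA); exists x.
move=> y Ay; have [a Aa] := A0.
have y0 : 0 <= y by apply: le_trans (Age0 _ Aa) (Ay _ Aa).
rewrite (eqRe y y0) lecR; apply: ge_sup; first by case: supA.
by move=> _ [x Ax <-]; move: (Ay x Ax); rewrite lecE => /andP[].
Qed.

Lemma real_or_complex_conj (K : numFieldType) (conj : K -> K) :
  real_or_complex conj -> forall a, a * conj a = `|a| ^+ 2.
Proof.
case=> R a; last by rewrite sqr_normc.
by rewrite /= real_normK ?num_real // expr2.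
Qed.

(** * Scalar limits and geometric series *)

Section Limits.
Context {K : numFieldType}.

(** The order on [K] may be partial, so nonnegativity is passed to the limit as the equation |x| =
    x, which continuity of the norm preserves. *)
Lemma cvg_ge0 (u : nat -> K) (l : K) :
  u @ \oo --> l -> (\forall n \near \oo, 0 <= u n) -> 0 <= l.
Proof.
move=> ul u0; rewrite ger0_def; apply/eqP.
apply: (@cvg_unique _ (@norm_hausdorff _ K^o) (u @ \oo)) => //.
apply: cvg_trans (cvg_norm ul); apply: near_eq_cvg.
by near do rewrite ger0_norm //.
Unshelve. all: by end_near. Qed.

Lemma cvg_norm_le (V : normedModType K) (u : nat -> V) (l : V) (c : K) :
  u @ \oo --> l -> (\forall n \near \oo, `|u n| <= c) -> `|l| <= c.
Proof.
move=> ul uc; rewrite -subr_ge0.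
apply: (@cvg_ge0 (fun n => c - `|u n|)).
  by apply: cvgB; [exact: cvg_cst|exact: cvg_norm].
by near do rewrite subr_ge0.
Unshelve. all: by end_near. Qed.

Hypothesis lubK : has_lubs K.

Lemma nondecreasing_bounded_cvg (u : nat -> K) (M : K) :
  {homo u : m n / (m <= n)%N >-> m <= n} ->
  (forall n, 0 <= u n) -> (forall n, u n <= M) ->
  exists l, [/\ u @ \oo --> l, forall n, u n <= l & l <= M].
Proof.
move=> ndu u0 uM.
have [|||s [ubs lbs]] := lubK (A := range u).
- by exists (u 0%N), 0%N.
- by move=> _ [n _ <-]; exact: u0.
- by exists M => _ [n _ <-].
have us n : u n <= s by apply: ubs; exists n.
exists s; split=> //; last by apply: lbs => _ [n _ <-].
have s0 : 0 <= s by apply: le_trans (u0 0%N) (us 0%N).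
apply/cvgrPdist_lt => e e0.
have [p sup] : exists p, s - e < u p.
  apply: contrapT => nex.
  suff : s <= s - e by rewrite lerBrDr gerDl => /(lt_le_trans e0); rewrite ltxx.
  apply: lbs => _ [n _ <-].
  (* Under a partial order, replacing [<=] by a negated [<] requires both sides to be real. *)
  have seR : s - e \is Num.real by rewrite realB ?ger0_real // ltW.
  rewrite real_leNgt ?(ger0_real (u0 n)) //.
  by apply/negP => ?; apply: nex; exists n.
exists p => // n /= pn.
rewrite ger0_norm ?subr_ge0 // ltrBlDr addrC -ltrBlDr.
exact: lt_le_trans sup (ndu _ _ pn).
Qed.

Lemma series_ge0_cvg (u : nat -> K) (M : K) :
  (forall n, 0 <= u n) -> (forall n, series u n <= M) ->
  cvgn (series u) /\ limn (series u) <= M.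
Proof.
move=> u0 uM.
have [||//|l [ul _ lM]] := @nondecreasing_bounded_cvg (series u) M.
- by apply: nondecreasing_series.
- by move=> n; apply: sumr_ge0.
- split; first by apply/cvg_ex; exists l.
  by rewrite (cvg_lim (@norm_hausdorff _ K^o) ul).
Qed.

Lemma series_ge0_le_limn (u : nat -> K) n :
  (forall n, 0 <= u n) -> cvgn (series u) -> series u n <= limn (series u).
Proof.
move=> u0 cu; rewrite -subr_ge0.
apply: (@cvg_ge0 (fun m => series u m - series u n)).
  by apply: cvgB => //; exact: cvg_cst.
by exists n => // m /= nm; rewrite subr_ge0; apply: nondecreasing_series.
Qed.

(** The sequence 1 - e^n is nondecreasing and bounded, hence convergent; shifting the index shows
    that the limit of e^n is fixed under multiplication by e < 1, so it is 0. *)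
Lemma expr_cvg0 (e : K) : 0 <= e -> e < 1 -> e ^+ n @[n --> \oo] --> 0.
Proof.
move=> e0 e1.
have e_le1 n : e ^+ n <= 1 by rewrite exprn_ile1 // ltW.
have [||n|l [ul _ _]] := @nondecreasing_bounded_cvg (fun n => 1 - e ^+ n) 1.
- by move=> m n mn; rewrite lerB // ler_wiXn2l // ltW.
- by move=> n; rewrite subr_ge0.
- by rewrite gerBl exprn_ge0.
have el : e ^+ n @[n --> \oo] --> 1 - l.
  rewrite (_ : (fun n => e ^+ n) = (fun n => 1 - (1 - e ^+ n))).
    by apply: cvgB => //; exact: cvg_cst.
  by apply/funext => n; rewrite subKr.
have eel : e ^+ n.+1 @[n --> \oo] --> e * (1 - l).
  rewrite (_ : (fun n => e ^+ n.+1) = (fun n => e * e ^+ n)).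
    by apply: cvgM => //; exact: cvg_cst.
  by apply/funext => n; rewrite exprS.
have el' : e ^+ n.+1 @[n --> \oo] --> 1 - l.
  by rewrite (cvg_shiftS (fun n => e ^+ n)).
have /eqP : e * (1 - l) = 1 - l.
  exact: (cvg_unique (@norm_hausdorff _ K^o) eel el').
rewrite -subr_eq0 -{2}[1 - l]mul1r -mulrBl mulf_eq0 subr_eq0.
by rewrite (lt_eqF e1) /= => /eqP l0; rewrite l0 in el.
Qed.

Lemma geometric_series_cvg (V : completeNormedModType K) (u : nat -> V)
    (C e : K) : 0 <= e -> e < 1 -> (forall n, `|u n| <= C * e ^+ n) ->
  cvgn (series u) /\
  forall n, `|limn (series u) - series u n| <= C * e ^+ n / (1 - e).
Proof.
move=> e0 e1 ule.
have C0 : 0 <= C by have := ule 0%N; rewrite expr0 mulr1; exact: le_trans.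
have e1' : 0 <= 1 - e by rewrite subr_ge0 ltW.
have sule m n : (m <= n)%N -> `|series u n - series u m| <= C * e ^+ m / (1 - e).
  move=> mn; rewrite sub_series mn (le_trans (ler_norm_sum _ _ _)) //.
  (* The sharper bound with e^m - e^n is the one that the induction on [n] reproduces. *)
  apply: (@le_trans _ _ (C * (e ^+ m - e ^+ n) / (1 - e))).
    elim: n mn => [|n IHn].
      by rewrite leqn0 => /eqP ->; rewrite big_geq // subrr mulr0 mul0r.
    rewrite leq_eqVlt => /predU1P[->|mn].
      by rewrite big_geq // subrr mulr0 mul0r.
    rewrite big_nat_recr //= (le_trans (lerD (IHn mn) (ule n))) //.
    rewrite le_eqVlt; apply/orP; left; apply/eqP; rewrite exprS; field.
    by rewrite subr_eq0 eq_sym lt_eqF.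
  rewrite ler_wpM2r ?invr_ge0 // ler_wpM2l //.
  by rewrite gerBl exprn_ge0.
have cu : cvgn (series u).
  apply/cauchy_cvgP/cauchy_seriesP => a a0.
  have : C * e ^+ n / (1 - e) @[n --> \oo] --> 0.
    rewrite -(mul0r (1 - e)^-1) -[X in X * _](mulr0 C).
    apply: cvgM; last exact: cvg_cst.
    by apply: cvgM; [exact: cvg_cst|exact: expr_cvg0].
  move=> /cvgr0Pnorm_lt /(_ a a0) [N _ Na].
  exists ([set n | (N <= n)%N], setT) => /=.
    by split; [exists N|exact: filterT].
  move=> [m n] /= [Nm _].
  have [mn|/ltnW nm] := leqP m n; last by rewrite big_geq // normr0.
  have := sule m n mn; rewrite sub_series mn => /le_lt_trans; apply.
  by rewrite (le_lt_trans _ (Na _ Nm)) // ger0_norm // !mulr_ge0 ?exprn_ge0 ?invr_ge0.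
split=> // n; apply: (@cvg_norm_le _ (fun m => series u m - series u n)).
  by apply: cvgB => //; exact: cvg_cst.
by exists n => // m /= nm; exact: sule.
Qed.

End Limits.

(** * Bounded operators and the operator norm *)

Section BoundedOperators.
Context {K : numFieldType} {H : normedModType K}.
Implicit Types (A : H -> H) (c : K).

Lemma linear_bounded_op A c :
  linear A -> (forall x, `|A x| <= c * `|x|) -> bounded_op A.
Proof.
move=> linA Ac; split=> //.
pose A' : {linear H -> H} := HB.pack A (GRing.isLinear.Build K H H *:%R A linA).
rewrite -[A]/(A' : H -> H); apply: bounded_linear_continuous.
(* Only c |x| is known to be nonnegative, whence c |x| = |c| |x|; this explains the witness |c|. *)
apply/ex_bound; exists `|c|; near=> x => /=.
rewrite (le_trans (Ac x)) //.
have c0 : 0 <= c * `|x| by apply: le_trans (Ac x).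
have := ger0_norm c0; rewrite normrM normr_id => <-; rewrite ler_piMr //.
Unshelve. all: by end_near. Qed.

Lemma linear_map0 A : linear A -> A 0 = 0.
Proof.
move=> linA; have := linA 1 0 0; rewrite !scale1r addr0 => /eqP.
by rewrite -[X in X == _]addr0 (inj_eq (addrI _)) => /eqP.
Qed.

Lemma linear_mapB A x y : linear A -> A (x - y) = A x - A y.
Proof. by move=> linA; rewrite addrC -scaleN1r linA scaleN1r addrC. Qed.

Lemma linear_mapD A x y : linear A -> A (x + y) = A x + A y.
Proof. by move=> linA; rewrite -[x]scale1r linA !scale1r. Qed.

Lemma linear_mapZ A a x : linear A -> A (a *: x) = a *: A x.
Proof. by move=> linA; rewrite -[a *: x]addr0 linA linear_map0 // addr0. Qed.

Lemma linear_map_sum A (u : nat -> H) m n : linear A ->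
  A (\sum_(m <= k < n) u k) = \sum_(m <= k < n) A (u k).
Proof.
move=> linA; apply: (big_morph A) => [x y|]; first exact: linear_mapD.
exact: linear_map0.
Qed.

Hypothesis lubK : has_lubs K.

Let unit_values A := [set `|A x| | x in [set x : H | `|x| <= 1]].

(** Excludes the default 0 in [supremum]: the values on the unit ball have the upper bound |c|. *)
Lemma unit_values_supremum A c :
  linear A -> (forall x, `|A x| <= c * `|x|) ->
  supremums (unit_values A) (opnorm A).
Proof.
move=> linA Ac.
have A0 : unit_values A !=set0 by exists `|A 0|, 0 => //=; rewrite normr0.
rewrite /opnorm /supremum; case: eqP => [E|_].
  by move: A0; rewrite /unit_values E => -[].
apply: xgetPex; apply: lubK => //; first by move=> _ [x _ <-] /=.
exists `|c| => _ [x /= x1 <-].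
have c0 : 0 <= c * `|x| by apply: le_trans (Ac x).
by rewrite (le_trans (Ac x)) // -(ger0_norm c0) normrM normr_id ler_piMr.
Qed.

Lemma opnorm_leP A c : 0 <= c ->
  linear A -> (forall x, `|A x| <= c * `|x|) -> 0 <= opnorm A <= c.
Proof.
move=> c0 linA Ac; have [ub lub] := unit_values_supremum linA Ac.
apply/andP; split.
  have := ub `|A 0|; rewrite linear_map0 // normr0; apply.
  by exists 0; rewrite /= ?linear_map0 ?normr0.
apply: lub => _ [x /= x1 <-]; apply: le_trans (Ac x) _.
by rewrite ler_piMr.
Qed.

Lemma le_opnorm A x : bounded_op A -> `|A x| <= opnorm A * `|x|.
Proof.
move=> [linA cA].
have [c c0 Ac] : exists2 c, 0 < c & forall x, `|A x| <= c * `|x|.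
  pose A' : {linear H -> H} :=
    HB.pack A (GRing.isLinear.Build K H H *:%R A linA).
  exact: (@linear_lipschitz _ _ _ A').
have [ub _] := unit_values_supremum linA Ac.
have [->|x0] := eqVneq x 0; first by rewrite linear_map0 // !normr0 mulr0.
have nx0 : 0 < `|x| by rewrite normr_gt0.
rewrite -ler_pdivrMr // -[_ / _]mulrC.
have -> : `|x|^-1 * `|A x| = `|A (`|x|^-1 *: x)|.
  by rewrite linear_mapZ // normrZ normfV normr_id.
apply: ub; exists (`|x|^-1 *: x) => //=.
by rewrite normrZ normfV normr_id mulVf // gt_eqF.
Qed.

Lemma bounded_op_cvg A (u : nat -> H) (l : H) :
  bounded_op A -> u @ \oo --> l -> A (u n) @[n --> \oo] --> A l.
Proof. by move=> [_ cA] ul; apply: continuous_cvg => //; exact: cA. Qed.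

End BoundedOperators.

(** * Neumann series *)

Section Neumann.
Context {K : numFieldType} {H : completeNormedModType K}.
Hypothesis lubK : has_lubs K.

(** Summed pointwise, so that completeness of [H] suffices; for a strict contraction this is (I -
    A)^-1 x. *)
Definition neumann (A : H -> H) (x : H) : H :=
  limn (series (fun n => iter n A x)).

Variables (A : H -> H) (e : K).
Hypotheses (linA : linear A) (Ae : forall x, `|A x| <= e * `|x|).
Hypotheses (e0 : 0 <= e) (e1 : e < 1).

Lemma iter_norm_le n x : `|iter n A x| <= e ^+ n * `|x|.
Proof.
elim: n => [|n IHn] /=; first by rewrite expr0 mul1r.
by rewrite (le_trans (Ae _)) // exprS -mulrA ler_wpM2l.
Qed.

Lemma iter_linear n : linear (iter n A).
Proof. by elim: n => [|n IHn] // a x y; rewrite !iterS IHn linA. Qed.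

Lemma neumann_cvg x : series (fun n => iter n A x) @ \oo --> neumann A x.
Proof.
apply: (proj1 (geometric_series_cvg lubK (C := `|x|) e0 e1 _)) => n.
by rewrite mulrC iter_norm_le.
Qed.

(** The tail of the geometric series. The case n = 0 gives the norm bound, and large n the
    convergence in operator norm. *)
Lemma neumann_dist x n :
  `|neumann A x - series (fun n => iter n A x) n| <= e ^+ n / (1 - e) * `|x|.
Proof.
rewrite (_ : _ * `|x| = `|x| * e ^+ n / (1 - e)); last by ring.
apply: (proj2 (geometric_series_cvg lubK (C := `|x|) e0 e1 _)) => {}n.
by rewrite mulrC iter_norm_le.
Qed.

Lemma neumann_norm_le x : `|neumann A x| <= (1 - e)^-1 * `|x|.
Proof.
by have := neumann_dist x 0; rewrite seriesEnat /= big_geq // subr0 mul1r.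
Qed.

Lemma neumann_linear : linear (neumann A).
Proof.
move=> a x y; apply/(cvg_lim (@norm_hausdorff _ H)).
rewrite (_ : series _ = fun n => a *: series (fun n => iter n A x) n +
    series (fun n => iter n A y) n).
  by apply: cvgD; [apply: cvgZl_tmp|]; exact: neumann_cvg.
apply/funext => n; rewrite /series /= scaler_sumr -big_split /=.
by apply: eq_bigr => k _; exact: iter_linear.
Qed.

(** Peeling off the term of index 0 leaves the series at [A x]; this becomes the left inverse
    identity for I - A. *)
Lemma neumannE x : neumann A x = x + neumann A (A x).
Proof.
have cx : series (fun n => iter n A x) n.+1 @[n --> \oo] --> neumann A x.
  by rewrite (cvg_shiftS (series (fun n => iter n A x))); exact: neumann_cvg.
apply: (cvg_unique (@norm_hausdorff _ H) cx).
rewrite (_ : (fun n => _) = fun n => x + series (fun n => iter n A (A x)) n).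
  by apply: cvgD; [exact: cvg_cst|exact: neumann_cvg].
apply/funext => n; rewrite !seriesEnat /= big_nat_recl //=; congr (_ + _).
by apply: eq_bigr => k _; rewrite -iterSr iterS.
Qed.

(** Continuity lets [A] pass through the limit; this becomes the right inverse identity. *)
Lemma neumannE_l x : neumann A x = x + A (neumann A x).
Proof.
rewrite {1}neumannE; congr (_ + _); apply/esym.
have bA := linear_bounded_op linA Ae.
apply: (cvg_unique (@norm_hausdorff _ H) (bounded_op_cvg bA (@neumann_cvg x))).
rewrite (_ : (fun n => _) = series (fun n => iter n A (A x))) //.
  exact: neumann_cvg.
apply/funext => n; rewrite !seriesEnat /= linear_map_sum //.
by apply: eq_bigr => k _; rewrite -iterSr iterS.
Qed.

Lemma neumann_inverse : bounded_inverse (idfun \- A) (neumann A).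
Proof.
split.
- apply: (@linear_bounded_op _ _ _ (1 + e)) => [a x y|x] /=.
    by rewrite linA scalerBr opprD addrACA.
  by rewrite (le_trans (ler_normB _ _)) // mulrDl mul1r lerD2l.
- exact: linear_bounded_op neumann_linear neumann_norm_le.
- move=> x /=; rewrite linear_mapB; last exact: neumann_linear.
  by rewrite {1}neumannE addrK.
- by move=> x /=; rewrite {1}neumannE_l addrK.
Qed.

Lemma neumann_opnorm_cvg :
  opnorm_cvg (fun N x => x + \sum_(1 <= n < N.+1) iter n A x) (neumann A).
Proof.
have dist n x : `|x + \sum_(1 <= k < n.+1) iter k A x - neumann A x| <=
    e ^+ n.+1 / (1 - e) * `|x|.
  (* With the identity counted, the sum up to index n has n + 1 terms of the series. *)
  have := neumann_dist x n.+1; rewrite distrC seriesEnat /=.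
  by rewrite big_ltn.
have lin n : linear
    ((fun x => x + \sum_(1 <= k < n.+1) iter k A x) \- neumann A).
  move=> a x y /=; rewrite neumann_linear.
  under eq_bigr do rewrite iter_linear.
  by rewrite big_split /= -scaler_sumr addrACA -scalerDr scalerBr opprD addrACA.
split=> [n|]; first exact: linear_bounded_op (lin n) (dist n).
apply/cvgr0Pnorm_le => a a0.
have : e ^+ n.+1 / (1 - e) @[n --> \oo] --> 0.
  rewrite -(mul0r (1 - e)^-1); apply: cvgM; last exact: cvg_cst.
  by rewrite (cvg_shiftS (fun n => e ^+ n)); exact: expr_cvg0.
move=> /cvgr0Pnorm_le /(_ a a0); apply: filterS => n.
have c0 : 0 <= e ^+ n.+1 / (1 - e).
  by apply: divr_ge0; [exact: exprn_ge0|rewrite subr_ge0 ltW].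
have /andP[nrm0 nrme] := opnorm_leP lubK c0 (lin n) (dist n).
by rewrite !ger0_norm //; exact: le_trans.
Qed.

End Neumann.

(** * Inner products and adjoint pairs *)

Section InnerProduct.
Context {K : numFieldType} {conj : K -> K} (hK : real_or_complex conj).
Context {H : normedModType K} (dot : {dot H for conj}).
Hypothesis hdot : forall x : H, `|x| ^+ 2 = dot x x.
Implicit Types (x y z : H) (A B : H -> H).

Lemma dotC x y : dot x y = conj (dot y x).
Proof. by have := @hermitian_subproof _ _ _ _ dot x y; rewrite expr0 mul1r. Qed.

Lemma dotZr a x y : dot x (a *: y) = conj a * dot x y.
Proof. exact: (linearZr_LR dot). Qed.

Lemma dotZl a x y : dot (a *: x) y = a * dot x y.
Proof. exact: (linearZl_LR dot). Qed.

Lemma dot0r x : dot x 0 = 0.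
Proof. exact: (linear0r dot). Qed.

Lemma dotDl x y z : dot (x + y) z = dot x z + dot y z.
Proof. exact: (linearDl dot). Qed.

Lemma dotBl x y z : dot (x - y) z = dot x z - dot y z.
Proof. exact: (linearBl dot). Qed.

Lemma dotBr x y z : dot x (y - z) = dot x y - dot x z.
Proof. exact: (linearBr dot). Qed.

Lemma dot_suml (u : nat -> H) m n y :
  dot (\sum_(m <= k < n) u k) y = \sum_(m <= k < n) dot (u k) y.
Proof.
apply: (big_morph (dot^~ y)); [move=> a b; exact: dotDl|exact: (linear0l dot)].
Qed.

Lemma dot_sumr (u : nat -> H) m n x :
  dot x (\sum_(m <= k < n) u k) = \sum_(m <= k < n) dot x (u k).
Proof.
apply: (big_morph (dot x)) => [a b|]; [exact: (linearDr dot)|exact: dot0r].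
Qed.

Lemma norm_dotC x y : `|dot x y| = `|dot y x|.
Proof.
apply/eqP; rewrite -(@eqrXn2 _ 2) //; apply/eqP.
by rewrite -!(real_or_complex_conj hK) -!dotC mulrC.
Qed.

Lemma cauchy_schwarz x y : `|dot x y| <= `|x| * `|y|.
Proof.
have [->|y0] := eqVneq y 0; first by rewrite dot0r !normr0 mulr0.
have ny : 0 < `|y| ^+ 2 by rewrite exprn_gt0 // normr_gt0.
rewrite -(ler_pXn2r (n := 2)) ?nnegrE ?mulr_ge0 //.
rewrite -(ler_pM2l ny) -subr_ge0.
(* Expanding this square gives |y|^2 (|x|^2 |y|^2 - |<x, y>|^2), the factor |y|^2 having been
   introduced to avoid division. *)
have : 0 <= `|(`|y| ^+ 2) *: x - dot x y *: y| ^+ 2 by rewrite exprn_ge0.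
rewrite [X in 0 <= X]hdot dotBl !dotBr !dotZl !dotZr -!hdot.
have -> : conj (`|y| ^+ 2) = `|y| ^+ 2 by rewrite hdot -dotC.
rewrite [dot y x]dotC -(real_or_complex_conj hK (dot x y)).
by congr (0 <= _); ring.
Qed.

Lemma dot_inj x y : (forall z, dot x z = dot y z) -> x = y.
Proof.
move=> xy; apply/eqP; rewrite -subr_eq0 -normr_eq0 -sqrf_eq0 hdot.
by rewrite dotBl xy subrr.
Qed.

Lemma dot_cvgl (u : nat -> H) x y :
  u @ \oo --> x -> dot (u n) y @[n --> \oo] --> dot x y.
Proof.
move=> ux; apply/cvgrPdist_lt => e e0.
have y1 : 0 < `|y| + 1 by rewrite ltr_wpDl.
move/cvgrPdist_lt : ux => /(_ (e / (`|y| + 1))); rewrite divr_gt0 //.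
move=> /(_ isT); apply: filterS => n; rewrite ltr_pdivlMr //.
apply: le_lt_trans; rewrite -dotBl (le_trans (cauchy_schwarz _ _)) //.
by rewrite ler_wpM2l // lerDl.
Qed.

Lemma dot_cvgr (u : nat -> H) x y :
  u @ \oo --> x -> dot y (u n) @[n --> \oo] --> dot y x.
Proof.
move=> ux; apply/cvgrPdist_lt => e e0.
have /cvgrPdist_lt /(_ e e0) := dot_cvgl (y := y) ux; apply: filterS => n.
by rewrite -dotBl -dotBr norm_dotC.
Qed.

(** Adjointness as a relation: every adjoint in the proof is exhibited explicitly, and the choice
    made in [adjoint] is resolved by [adjoint_pairE]. *)
Definition adjoint_pair A B := forall x y, dot (A x) y = dot x (B y).

Lemma adjoint_pair_sym A B : adjoint_pair A B -> adjoint_pair B A.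
Proof. by move=> AB x y; rewrite dotC -AB -dotC. Qed.

Lemma adjoint_pair_linear A B : adjoint_pair A B -> linear A.
Proof.
move=> AB a x y; apply: dot_inj => z.
by rewrite AB !dotDl !dotZl !AB.
Qed.

(** One has |A x|^2 = <x, B (A x)> <= |x| c |A x|, and a factor |A x| cancels. *)
Lemma adjoint_pair_norm_le A B c : adjoint_pair A B ->
  (forall x, `|B x| <= c * `|x|) -> forall x, `|A x| <= c * `|x|.
Proof.
move=> AB Bc x; have [Ax0|Ax0] := eqVneq (A x) 0.
  by rewrite Ax0 normr0; apply: le_trans (Bc x).
rewrite -(ler_pM2r (_ : 0 < `|A x|)) ?normr_gt0 // -expr2 hdot AB.
have -> : dot x (B (A x)) = `|dot x (B (A x))|.
  by rewrite ger0_norm // -AB -hdot exprn_ge0.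
rewrite (le_trans (cauchy_schwarz _ _)) // mulrAC mulrC ler_wpM2r //.
Qed.

Lemma adjoint_pairE A B : adjoint_pair A B -> adjoint dot A = B.
Proof.
move=> AB; apply/funext => y; rewrite /adjoint; case: xgetP => [z _ zy|/(_ (B y))].
  apply: dot_inj => x; rewrite dotC [RHS]dotC; congr conj.
  by rewrite -AB zy.
by case=> x; rewrite AB.
Qed.

End InnerProduct.

(** Taken with [b] a Bessel bound, the part weighted by [b^-1] is at most half of the quantity being
    estimated and is absorbed by it. *)
Lemma weighted_AM_GM (K : numFieldType) (b s t : K) : 0 < b -> 0 <= s -> 0 <= t ->
  s * t <= (b * s ^+ 2 + b^-1 * t ^+ 2) / 2.
Proof.
move=> b0 s0 t0; rewrite -subr_ge0.
have -> : (b * s ^+ 2 + b^-1 * t ^+ 2) / 2 - s * t =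
    (b * s - t) ^+ 2 / (2 * b) by field; rewrite gt_eqF.
have b0' := ltW b0.
apply: divr_ge0; last exact: mulr_ge0.
by apply: real_exprn_even_ge0 => //; rewrite realB ?realM ?ger0_real.
Qed.

(** * Bessel sequences and frame bounds *)

Section Frames.
Context {K : numFieldType} {conj : K -> K} (hK : real_or_complex conj).
Context {H : completeNormedModType K} (dot : {dot H for conj}).
Hypothesis hdot : forall x : H, `|x| ^+ 2 = dot x x.
Implicit Types (x y z : H) (A B L M : H -> H) (W V : set H) (F G : nat -> H).

Let lubK : has_lubs K := real_or_complex_has_lubs hK.

(** Finite windows of indices keep convergence out of the definition and cover Cauchy tails
    directly; [x] ranges over all of [H]. *)
Definition bessel (b : K) F := forall x m n,
  \sum_(m <= k < n) `|dot x (F k)| ^+ 2 <= b * `|x| ^+ 2.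

Lemma closed_subspaceZ W a x : closed_subspace W -> W x -> W (a *: x).
Proof. by move=> [W0 WD _] Wx; have := WD a x 0 Wx W0; rewrite addr0. Qed.

Lemma closed_subspaceD W x y : closed_subspace W -> W x -> W y -> W (x + y).
Proof. by move=> [_ WD _] Wx Wy; rewrite -[x]scale1r; apply: WD. Qed.

Lemma closed_subspaceB W x y : closed_subspace W -> W x -> W y -> W (x - y).
Proof.
by move=> cW Wx Wy; rewrite addrC -scaleN1r; have [_ WD _] := cW; apply: WD.
Qed.

Lemma closed_subspace_sum W (u : nat -> H) m n : closed_subspace W ->
  (forall k, W (u k)) -> W (\sum_(m <= k < n) u k).
Proof.
move=> cW Wu; apply: big_ind => // [|x y]; first by case: cW.
exact: closed_subspaceD.
Qed.

(** Expand |h|^2 as the sum of c_k <f_k, h> and apply [weighted_AM_GM] termwise. The Bessel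
    inequality is asked at [h] alone because [frame_bessel] first has it only on [W]. *)
Lemma bessel_synthesis_le b F (c : nat -> K) m n :
  let h := \sum_(m <= k < n) c k *: F k in 0 < b ->
  \sum_(m <= k < n) `|dot h (F k)| ^+ 2 <= b * `|h| ^+ 2 ->
  `|h| ^+ 2 <= b * \sum_(m <= k < n) `|c k| ^+ 2.
Proof.
move=> h b0 hF; set s := \sum_(_ <= _ < _) `|c _| ^+ 2.
have : `|h| ^+ 2 <= (b * s + b^-1 * (b * `|h| ^+ 2)) / 2.
  rewrite -(ger0_norm (exprn_ge0 2 (normr_ge0 h))) {1}hdot {1}/h dot_suml.
  rewrite (le_trans (ler_norm_sum _ _ _)) // normrX normr_id.
  apply: (@le_trans _ _ (\sum_(m <= k < n) (b * `|c k| ^+ 2 +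
      b^-1 * `|dot h (F k)| ^+ 2) / 2)).
    apply: ler_sum => k _; rewrite dotZl normrM (norm_dotC hK dot (F k)).
    exact: weighted_AM_GM.
  rewrite -mulr_suml big_split /= -!mulr_sumr ler_wpM2r // lerD2l.
  by rewrite ler_wpM2l // invr_ge0 ltW.
by rewrite mulKf ?gt_eqF // ler_pdivlMr // mulr_natr mulr2n lerD2r.
Qed.

(* Only elements of [W] occur in the frame inequality; the upper bound extends
   to [H] because [\sum_k <x, f_k> f_k] is in [W]. *)
Lemma frame_bessel W F : closed_subspace W -> frame dot W F ->
  exists2 b, 0 < b & bessel b F.
Proof.
move=> cW [WF [a [b [a0 ab Fab]]]]; have b0 : 0 < b := lt_le_trans a0 ab.
exists b => // x m n.
set s := \sum_(_ <= _ < _) _.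
have s0 : 0 <= s by apply: sumr_ge0 => k _; rewrite exprn_ge0.
pose h := \sum_(m <= k < n) dot x (F k) *: F k.
have Wh : W h.
  by apply: closed_subspace_sum => // k; apply: closed_subspaceZ.
have hF : \sum_(m <= k < n) `|dot h (F k)| ^+ 2 <= b * `|h| ^+ 2.
  have [cF _ Fb] := Fab h Wh; apply: le_trans Fb.
  have ge0 k : 0 <= `|dot h (F k)| ^+ 2 by rewrite exprn_ge0.
  apply: le_trans (series_ge0_le_limn n ge0 cF); rewrite seriesEnat /=.
  have [mn|/ltnW nm] := leqP m n; last by rewrite big_geq // sumr_ge0.
  by rewrite [leRHS](big_cat_nat (n := m)) //= lerDr sumr_ge0.
have hs : `|h| ^+ 2 <= b * s by exact: bessel_synthesis_le.
have sx : s <= `|x| * `|h|.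
  have sE : s = dot h x.
    rewrite /h dot_suml; apply: eq_bigr => k _.
    by rewrite dotZl (dotC dot (F k)) -(real_or_complex_conj hK).
  by rewrite -(ger0_norm s0) {1}sE mulrC (cauchy_schwarz hK hdot).
have : s <= (b * `|x| ^+ 2 + b^-1 * (b * s)) / 2.
  rewrite (le_trans sx) // (le_trans (weighted_AM_GM b0 _ _)) //.
  by rewrite ler_wpM2r // lerD2l ler_wpM2l // invr_ge0 ltW.
by rewrite mulKf ?gt_eqF // ler_pdivlMr // mulr_natr mulr2n lerD2r.
Qed.

Lemma bessel_series_cvg b F x : bessel b F ->
  cvgn (series (fun k => `|dot x (F k)| ^+ 2)) /\
  limn (series (fun k => `|dot x (F k)| ^+ 2)) <= b * `|x| ^+ 2.
Proof.
move=> bF; apply: series_ge0_cvg => // n.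
by rewrite seriesEnat; apply: bF.
Qed.

Lemma bessel_synthesis_cvg b b' F G x : 0 < b -> bessel b F -> bessel b' G ->
  series (fun k => dot x (G k) *: F k) @ \oo --> synthesis F (analysis dot G x).
Proof.
move=> b0 bF bG; apply/cauchy_cvgP/cauchy_seriesP => e e0.
have [cG _] := bessel_series_cvg x bG.
(* The squared norm of a window is at most b times the same window of the sum of |<x, g_k>|^2. *)
have eb : 0 < e ^+ 2 / b by rewrite divr_gt0 ?exprn_gt0.
have cauG : cauchy ((series (fun k => `|dot x (G k)| ^+ 2) : nat -> K^o) @ \oo).
  exact: cvg_cauchy.
have := proj1 (@cauchy_seriesP K K^o (fun k => `|dot x (G k)| ^+ 2)) cauG _ eb.
apply: filterS => -[m n] /=.
rewrite ger0_norm; last by apply: sumr_ge0 => k _; rewrite exprn_ge0.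
rewrite ltr_pdivlMr // mulrC => sb.
rewrite -(ltr_pXn2r (n := 2)) ?nnegrE ?(ltW e0) //.
by apply: le_lt_trans sb; apply: bessel_synthesis_le.
Qed.

(** The partial sums are adjoint term by term, and continuity of [dot] carries this to the
    limits. *)
Lemma adjoint_pair_synthesis b b' F G : 0 < b -> 0 < b' ->
  bessel b F -> bessel b' G ->
  adjoint_pair dot (synthesis F \o analysis dot G) (synthesis G \o analysis dot F).
Proof.
move=> b0 b0' bF bG x y /=.
have cl := dot_cvgl hK hdot (y := y) (bessel_synthesis_cvg (x := x) b0 bF bG).
have cr := dot_cvgr hK hdot (y := x) (bessel_synthesis_cvg (x := y) b0' bG bF).
apply: (cvg_unique (@norm_hausdorff _ K^o) cl).
rewrite (_ : (fun n => _) = fun n =>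
  dot x (series (fun k => dot y (F k) *: G k) n)) //.
apply/funext => n; rewrite !seriesEnat /= dot_suml dot_sumr.
by apply: eq_bigr => k _; rewrite dotZl dotZr -dotC mulrC.
Qed.

Lemma synthesis_delta F k : synthesis F (delta k) = F k.
Proof.
apply/(cvg_lim (@norm_hausdorff _ H)); apply: cvg_near_cst.
exists k.+1 => // n /= kn; rewrite seriesEnat /= (bigD1_seq k) ?iota_uniq //=.
  rewrite /delta eqxx scale1r big1 ?addr0 // => j /negPf ->.
  by rewrite scale0r.
by rewrite mem_index_iota.
Qed.

Lemma synthesis_comp A b b' F G x : bounded_op A ->
  0 < b -> bessel b F -> bessel b' G ->
  synthesis (A \o F) (analysis dot G x) = A (synthesis F (analysis dot G x)).
Proof.
move=> bA b0 bF bG; apply/(cvg_lim (@norm_hausdorff _ H)).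
have := bounded_op_cvg bA (bessel_synthesis_cvg (x := x) b0 bF bG).
rewrite (_ : (fun n => _) = series (fun k => analysis dot G x k *: (A \o F) k)) //.
case: bA => linA _; apply/funext => n; rewrite !seriesEnat /= linear_map_sum //.
by apply: eq_bigr => k _; rewrite linear_mapZ.
Qed.

Lemma synthesis_closed_subspace W b b' F G x : closed_subspace W ->
  (forall k, W (F k)) -> 0 < b -> bessel b F -> bessel b' G ->
  W (synthesis F (analysis dot G x)).
Proof.
move=> cW WF b0 bF bG; have [_ _ clW] := cW.
apply: (closed_cvg _ clW) (bessel_synthesis_cvg (x := x) b0 bF bG).
apply: nearW => n; rewrite seriesEnat; apply: closed_subspace_sum => // k.
exact: closed_subspaceZ.
Qed.

(** Moving [A] across the product gives the Bessel sum of [F] at [B x], so the bound of the adjoint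
    enters. *)
Lemma bessel_comp A B b c F : adjoint_pair dot A B -> 0 <= b ->
  (forall x, `|B x| <= c * `|x|) -> bessel b F -> bessel (b * c ^+ 2) (A \o F).
Proof.
move=> AB b0 Bc bF x m n /=.
under eq_bigr do rewrite (norm_dotC hK) AB (norm_dotC hK).
apply: le_trans (bF _ _ _) _; rewrite -mulrA -exprMn ler_wpM2l //.
by rewrite ler_pXn2r ?nnegrE // (le_trans _ (Bc x)).
Qed.

Lemma analysis_comp A B F x : adjoint_pair dot A B ->
  analysis dot (A \o F) x = analysis dot F (B x).
Proof.
move=> AB; apply/funext => k.
by rewrite /analysis /= (adjoint_pair_sym AB).
Qed.

(** Expand |x|^2 as the sum of <x, g_k> <f_k, x>; by [weighted_AM_GM] the Bessel bound [b] of [F]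
    gives the lower bound [b^-1] for [G]. *)
Lemma bessel_frame V b b' F G : 0 < b -> 0 < b' -> bessel b F -> bessel b' G ->
  (forall k, V (G k)) ->
  (forall x, V x -> dot (synthesis F (analysis dot G x)) x = `|x| ^+ 2) ->
  frame dot V G.
Proof.
move=> b0 b0' bF bG VG FGx; split=> //.
have ib0 : 0 < b^-1 by rewrite invr_gt0.
(* Adding [b^-1] to the Bessel bound makes the upper constant at least the lower one. *)
exists b^-1, (b' + b^-1); split=> //; first by rewrite lerDr ltW.
move=> x Vx u; have [cu ub] := bessel_series_cvg x bG; split=> //; last first.
  apply: le_trans ub _; rewrite mulrDl lerDl.
  by rewrite mulr_ge0 ?exprn_ge0 // ltW.
have ge0 k : 0 <= `|dot x (G k)| ^+ 2 by rewrite exprn_ge0.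
rewrite mulrC ler_pdivrMr // mulrC.
have : `| `|x| ^+ 2 | <= (b * limn u + b^-1 * (b * `|x| ^+ 2)) / 2.
  rewrite -{1}(FGx x Vx).
  apply: (cvg_norm_le (dot_cvgl hK hdot (bessel_synthesis_cvg (x := x) b0 bF bG))).
  apply: nearW => n; rewrite seriesEnat dot_suml.
  apply: le_trans (ler_norm_sum _ _ _) _.
  apply: (@le_trans _ _ (\sum_(0 <= k < n) (b * `|dot x (G k)| ^+ 2 +
      b^-1 * `|dot x (F k)| ^+ 2) / 2)).
    apply: ler_sum => k _; rewrite dotZl normrM (norm_dotC hK dot (F k)).
    exact: weighted_AM_GM.
  rewrite -mulr_suml big_split /= -!mulr_sumr ler_wpM2r // lerD //.
    rewrite ler_wpM2l ?(ltW b0) //.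
    by have := series_ge0_le_limn n ge0 cu; rewrite seriesEnat.
  by rewrite ler_wpM2l ?(ltW ib0) //; exact: bF.
rewrite ger0_norm ?exprn_ge0 // mulKf ?gt_eqF //.
by rewrite ler_pdivlMr // mulr_natr mulr2n lerD2r.
Qed.
End Frames.

(** * Oblique projections and the dual decomposition *)

Section ObliqueProjection.
Context {K : numFieldType} {conj : K -> K} (hK : real_or_complex conj).
Context {H : completeNormedModType K} (dot : {dot H for conj}).
Hypothesis hdot : forall x : H, `|x| ^+ 2 = dot x x.
Implicit Types (x y z : H) (W V : set H).

Lemma oblique_projP W U x : (exists2 w, W w & U (x - w)) ->
  W (oblique_proj W U x) /\ U (x - oblique_proj W U x).
Proof.
move=> [w Ww Uw]; rewrite /oblique_proj.
by case: xgetP => [//|/(_ w)]; case.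
Qed.

Lemma direct_sum_decomposition W U x : direct_sum W U ->
  exists2 w, W w & U (x - w).
Proof.
move=> [WU _]; have : [set w + u | w in W & u in U] x by rewrite WU.
by move=> [w Ww [u Uu <-]]; exists w => //; rewrite addrAC subrr add0r.
Qed.

Lemma orthc_sub V x y : orthc dot V x -> orthc dot V y -> orthc dot V (x - y).
Proof. by move=> Vx Vy v Vv; rewrite dotBl Vx // Vy // subr0. Qed.

Lemma oblique_proj_uniq W V x w : closed_subspace W ->
  direct_sum W (orthc dot V) -> W w -> orthc dot V (x - w) ->
  oblique_proj W (orthc dot V) x = w.
Proof.
move=> cW WV Ww Vw.
have [WP VP] := oblique_projP (direct_sum_decomposition x WV).
apply/eqP; rewrite -subr_eq0; apply/eqP.
have [_ W0] := WV.
suff : (W `&` orthc dot V) (oblique_proj W (orthc dot V) x - w) by rewrite W0.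
split; first exact: closed_subspaceB.
by have := orthc_sub Vw VP; rewrite opprB addrC addrA subrK.
Qed.

(* With [P] and [Q] the projections, [(I - A)^n] tends to [I - Q] although
   [I - A] need not be a contraction: its powers are adjoint to
   [(I - B)^n = E^n + (I - P)].  This produces the decomposition
   [H = V + W^perp] without appeal to duality theorems. *)
Lemma oblique_decomposition W V (P A B E : H -> H) (e : K) :
  closed_subspace V -> 0 <= e -> e < 1 ->
  adjoint_pair dot A B -> (forall x, V (A x)) ->
  (forall y, E y = P y - B y) -> (forall x, `|E x| <= e * `|x|) ->
  (forall y, P (E y) = E y) -> (forall y, P (y - P y) = 0) ->
  (forall y, E (y - P y) = 0) -> (forall w, W w -> P w = w) ->
  forall x, exists2 v, V v & orthc dot W (x - v).
Proof.
move=> cV e0 e1 AB VA EPB Ee PE P0 E0 PW x.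
have linB := adjoint_pair_linear hdot (adjoint_pair_sym AB).
pose T x := x - A x; pose S y := y - B y.
have TS n : adjoint_pair dot (iter n T) (iter n S).
  elim: n => [|n IHn] // u y.
  by rewrite iterS iterSr -IHn /T dotBl AB -dotBr.
have BE y : B y = P y - E y by rewrite EPB subKr.
have iterS_E n y : iter n.+1 S y = iter n.+1 E y + (y - P y).
  elim: n => [|n IHn]; first by rewrite /= /S BE opprB addrCA.
  rewrite iterS IHn /S (linear_mapD _ _ linB) (BE (y - P y)) P0 E0 subrr addr0.
  rewrite BE {2}[iter n.+1 E y]iterS PE -!iterS opprB addrAC; congr (_ + _).
  by rewrite addrCA subrr addr0.
pose z n := iter n.+1 T x; pose d n := z n.+1 - z n.
have zE n y : dot (z n) y = dot x (iter n.+1 E y + (y - P y)).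
  by rewrite TS iterS_E.
(* Tested against y = [d n], the parts y - P y cancel, leaving two iterates of [E] of norm at most
   e^n |y| each. *)
have dle n : `|d n| <= 2 * `|x| * e ^+ n.
  have [->|d0] := eqVneq (d n) 0.
    by rewrite normr0 !mulr_ge0 ?exprn_ge0.
  rewrite -(ler_pM2r (_ : 0 < `|d n|)) ?normr_gt0 // -expr2.
  rewrite -(ger0_norm (exprn_ge0 2 (normr_ge0 _))) hdot {1}/d dotBl !zE -dotBr.
  rewrite opprD addrACA subrr addr0 (le_trans (cauchy_schwarz hK hdot _ _)) //.
  rewrite [2 * _]mulrC -!mulrA ler_wpM2l // (le_trans (ler_normB _ _)) //.
  have iterE m : (n <= m)%N -> `|iter m E (d n)| <= e ^+ n * `|d n|.
    move=> nm; rewrite (le_trans (iter_norm_le Ee e0 _ _)) // ler_wpM2r //.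
    by rewrite ler_wiXn2l // ltW.
  by rewrite mulr_natl mulr2n lerD // iterE // ltnW.
have [cd _] := geometric_series_cvg (real_or_complex_has_lubs hK) e0 e1 dle.
have [l zl] : exists l : H, z n @[n --> \oo] --> l.
  exists (z 0%N + limn (series d)).
  have zE' n : z 0%N + series d n = z n.
    by rewrite seriesEnat /= telescope_sumr // addrC subrK.
  have : z 0%N + series d n @[n --> \oo] --> z 0%N + limn (series d).
    by apply: cvgD; [exact: cvg_cst|exact: cd].
  by under eq_fun do rewrite zE'.
exists (x - l).
  have [_ _ clV] := cV.
  have xzl : x - z n @[n --> \oo] --> x - l by apply: cvgB => //; exact: cvg_cst.
  apply: (closed_cvg _ clV) xzl; apply: nearW => n.
  (* Each step of [T] subtracts a value of [A], so x - T^m x stays in [V]. *)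
  rewrite /z; elim: n.+1 => [|m IHm] /=; first by rewrite subrr; case: cV.
  by rewrite /T opprB addrC -addrA addrC; apply: closed_subspaceD; rewrite // addrC.
move=> w Ww; rewrite subKr.
(* On [W] the part w - P w vanishes, so <z n, w> is this sequence; E^n w tends to 0 as the general
   term of a convergent Neumann series. *)
have xE0 : dot x (iter n.+1 E w) @[n --> \oo] --> 0.
  rewrite -(dot0r dot x); apply: dot_cvgr => //.
  rewrite (cvg_shiftS (fun n => iter n E w)); apply: cvg_series_cvg_0.
  apply/cvg_ex; exists (neumann E w).
  exact: (neumann_cvg (real_or_complex_has_lubs hK) Ee e0 e1).
apply: (cvg_unique (@norm_hausdorff _ K^o) (dot_cvgl hK hdot (y := w) zl)).
rewrite (_ : (fun n => _) = fun n => dot x (iter n.+1 E w)) //.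
by apply/funext => n; rewrite zE PW // subrr addr0.
Qed.
End ObliqueProjection.

(** * Neumann correction of approximate oblique duals *)

Theorem proposition5p3
  (K : numFieldType) (conj : K -> K) (hK : real_or_complex conj)
  (H : completeNormedModType K) (dot : {dot H for conj})
  (hdot : forall x : H, `|x| ^+ 2 = dot x x)
  (hsep : exists S : set H, countable S /\ dense S)
  (W V : set H) (hW : closed_subspace W) (hV : closed_subspace V)
  (hWV : direct_sum W (orthc dot V))
  (eps : K) (heps0 : 0 <= eps) (heps1 : eps < 1)
  (F G : nat -> H) (hFG : approx_oblique_dual dot W V eps F G) :
  let D : H -> H :=
    oblique_proj V (orthc dot W) \- (synthesis G \o analysis dot F) in
  exists L : H -> H,
    [/\ bounded_inverse (idfun \- D) L,
        opnorm_cvg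
          (fun N x => x + \sum_(1 <= n < N.+1) iter n D x) L &
        let Gt : nat -> H := fun k => L (synthesis G (delta k)) in
        let Ft : nat -> H := fun k => adjoint dot L (synthesis F (delta k)) in
        [/\ oblique_dual dot W V F Gt,
            oblique_dual dot W V Ft G &
            approx_oblique_dual dot W V (eps / (1 - eps)) Ft Gt]].
Proof.
have lubK := real_or_complex_has_lubs hK.
have [frF frG [bE nE]] := hFG; have linE := proj1 bE.
set P := oblique_proj W (orthc dot V) in bE nE linE.
set B := synthesis F \o analysis dot G in bE nE linE.
set E := P \- B in bE nE linE.
pose A := synthesis G \o analysis dot F.
move=> D.
have Ee x : `|E x| <= eps * `|x|.
  by apply: le_trans (le_opnorm lubK _ bE) _; rewrite ler_wpM2r.
have [WF VG] : (forall k, W (F k)) /\ (forall k, V (G k)).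
  by case: frF frG => ? _ [].
have [b b0 bF] := frame_bessel hK hdot hW frF.
have [b' b0' bG] := frame_bessel hK hdot hV frG.
have BA : adjoint_pair dot B A := adjoint_pair_synthesis hK hdot b0 b0' bF bG.
have AB := adjoint_pair_sym BA.
have linB := adjoint_pair_linear hdot BA.
have WB x : W (B x) := synthesis_closed_subspace hK hdot x hW WF b0 bF bG.
have VA x : V (A x) := synthesis_closed_subspace hK hdot x hV VG b0' bG bF.
have BV x : orthc dot V x -> B x = 0.
  move=> Vx; apply: (dot_inj hdot) => y.
  by rewrite BA (Vx _ (VA y)) (linear0l dot).
have PP x : W (P x) /\ orthc dot V (x - P x).
  exact: oblique_projP (direct_sum_decomposition x hWV).
have PW w : W w -> P w = w.
  move=> Ww; apply: oblique_proj_uniq => //; rewrite subrr => v _.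
  exact: (linear0l dot).
have PV u : orthc dot V u -> P u = 0.
  move=> Vu; apply: oblique_proj_uniq => //; last by rewrite subr0.
  by case: hW.
(* Linearity of [E] is part of the hypothesis on its norm, and P = E + B. *)
have linP : linear P.
  move=> a x y; have PE z : P z = E z + B z by rewrite /= subrK.
  by rewrite !PE linE linB addrACA -scalerDr.
have WE x : W (E x) by apply: closed_subspaceB => //; case: (PP x).
have EV u : orthc dot V u -> E u = 0.
  by move=> Vu; rewrite /E /= PV // BV // subr0.
(* This existence makes [Q] below a genuine projection rather than the default 0 of [xget]. *)
have Qex x : exists2 v, V v & orthc dot W (x - v).
  apply: (oblique_decomposition hK hdot (P := P) (E := E) hV heps0 heps1 AB) => // y.
  - exact: PW.
  - by apply: PV; case: (PP y).
  - by apply: EV; case: (PP y).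
pose Q := oblique_proj V (orthc dot W).
have QQ x : V (Q x) /\ orthc dot W (x - Q x) by exact: oblique_projP.
have QP : adjoint_pair dot Q P.
  move=> x y; have [VQ WQ] := QQ x; have [WPy VPy] := PP y.
  (* Both y - P y is orthogonal to [V] and x - Q x is orthogonal to [W], so each side equals <Q x, P
     y>. *)
  transitivity (dot (Q x) (P y)).
    by apply/eqP; rewrite -subr_eq0 -dotBr dotC VPy // -(dot0r dot 0) -dotC dot0r.
  by apply/esym/eqP; rewrite -subr_eq0 -dotBl WQ.
have DE : adjoint_pair dot D E.
  by move=> x y; rewrite [LHS]dotBl [RHS]dotBr; congr (_ - _); [exact: QP|exact: AB].
have De := adjoint_pair_norm_le hK hdot DE Ee.
have linD := adjoint_pair_linear hdot DE.
pose L := neumann D; pose M := neumann E.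
(* The iterates of [D] and [E] are adjoint, hence so are the partial sums and their limits; this
   identifies the adjoint of [L] as [M]. *)
have LM : adjoint_pair dot L M.
  move=> x y.
  have cl := dot_cvgl hK hdot (y := y) (neumann_cvg lubK De heps0 heps1 (x := x)).
  have cr := dot_cvgr hK hdot (y := x) (neumann_cvg lubK Ee heps0 heps1 (x := y)).
  apply: (cvg_unique (@norm_hausdorff _ K^o) cl).
  rewrite (_ : (fun n => _) = fun n =>
    dot x (series (fun k => iter k E y) n)) //.
  apply/funext => n; rewrite !seriesEnat /= dot_suml dot_sumr.
  apply: eq_bigr => k _; elim: k x y {cl cr} => [|k IHk] x y //.
  by rewrite iterS DE IHk -iterSr.
have ML := adjoint_pair_sym LM.
have Lc := neumann_norm_le lubK De heps0 heps1.
have Mc := neumann_norm_le lubK Ee heps0 heps1.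
have ME x : M x = x + M (E x) := neumannE lubK Ee heps0 heps1 x.
have EM x : M x = x + E (M x) := neumannE_l lubK linE Ee heps0 heps1 x.
have DL x : L x = x + D (L x) := neumannE_l lubK linD De heps0 heps1 x.
have linM : linear M := neumann_linear lubK linE Ee heps0 heps1.
have bM : bounded_op M := linear_bounded_op linM Mc.
have BE x : B x = P x - E x by rewrite /= subKr.
have PE x : P (E x) = E x by exact: PW.
have EP x : E (P x) = E x.
  apply/esym/eqP; rewrite -subr_eq0 -linear_mapB //.
  by apply/eqP/EV; case: (PP x).
(* Since P fixes E (M x), P (M x) = P x + E (M x), and the last term cancels in B = P - E. *)
have BM x : B (M x) = P x.
  by rewrite BE {1}EM linear_mapD // PE addrK.
have MB x : M (B x) = P x.
  by rewrite BE linear_mapB // {1}ME EP addrK.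
exists L; split.
- exact: neumann_inverse.
- exact: neumann_opnorm_cvg.
move=> Gt Ft.
have GtE : Gt = L \o G by apply/funext => k; rewrite /Gt synthesis_delta.
have FtE : Ft = M \o F.
  by apply/funext => k; rewrite /Ft synthesis_delta (adjoint_pairE hdot LM).
have VGt k : V (Gt k).
  (* [D] takes values in [V], so L g = g + D (L g) stays in [V]. *)
  rewrite GtE /= DL; apply: closed_subspaceD => //.
  by apply: closed_subspaceB => //; case: (QQ (L (G k))).
have WFt k : W (Ft k) by rewrite FtE /= EM; apply: closed_subspaceD.
set c := (1 - eps)^-1 in Lc Mc.
have c0 : 0 < c by rewrite invr_gt0 subr_gt0.
have bGt : bessel dot (b' * c ^+ 2) Gt.
  by rewrite GtE; apply: (bessel_comp hK LM (ltW b0') Mc).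
have bFt : bessel dot (b * c ^+ 2) Ft.
  by rewrite FtE; apply: (bessel_comp hK ML (ltW b0) Lc).
have bc0 : 0 < b * c ^+ 2 by rewrite mulr_gt0 ?exprn_gt0.
have bc0' : 0 < b' * c ^+ 2 by rewrite mulr_gt0 ?exprn_gt0.
have FGt : synthesis F \o analysis dot Gt = P.
  apply/funext => x; rewrite /= GtE (analysis_comp _ _ LM) //.
  exact: BM.
have FtG : synthesis Ft \o analysis dot G = P.
  apply/funext => x; rewrite /= FtE.
  by rewrite (synthesis_comp hK hdot x bM b0 bF bG) MB.
(* These two identities feed [bessel_frame]: x - P x is orthogonal to [V], and [P] fixes [W]. *)
have dotPV x : V x -> dot (P x) x = `|x| ^+ 2.
  move=> Vx; rewrite hdot; apply/esym/eqP; rewrite -subr_eq0 -dotBl.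
  by case: (PP x) => _ ->.
have dotQW x : W x -> dot x (P x) = `|x| ^+ 2 by move=> Wx; rewrite PW // hdot.
have frGt : frame dot V Gt.
  apply: (bessel_frame hK hdot b0 bc0' bF bGt VGt) => x Vx.
  by rewrite -dotPV // -FGt.
have frFt : frame dot W Ft.
  apply: (bessel_frame hK hdot b0' bc0 bG bFt WFt) => x Wx.
  (* The product needed here, of the synthesis of [G] with the analysis of [Ft], is adjoint to [P],
     so the identity becomes <x, P x> = |x|^2. *)
  have GFt := adjoint_pair_synthesis hK hdot b0' bc0 bG bFt.
  by rewrite -dotQW // -FtG -GFt.
split=> //; split=> //.
pose R x := P x - P (M x).
have -> : P \- (synthesis Ft \o analysis dot Gt) = R.
  apply/funext => x; rewrite /= GtE (analysis_comp _ _ LM) FtE /R.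
  by rewrite (synthesis_comp hK hdot (M x) bM b0 bF bG) MB.
have Rc x : `|R x| <= eps / (1 - eps) * `|x|.
  rewrite /R {1}EM linear_mapD // PE opprD addrA subrr add0r normrN.
  by rewrite (le_trans (Ee _)) // -mulrA ler_wpM2l.
have linR : linear R.
  by move=> a x y; rewrite /R linM !linP scalerBr opprD addrACA.
split; first exact: linear_bounded_op linR Rc.
have e0 : 0 <= eps / (1 - eps) by rewrite divr_ge0 // subr_ge0 ltW.
by have /andP[] := opnorm_leP lubK e0 linR Rc.
Qed.
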